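(* Let $n\ge 2$. There exist a scalar product on $\mathbb{R}^{\binom{n}{2}}$ and a decomposition $\mathbb{R}^{\binom{n}{2}} = V_1 \perp V_2$ into linear subspaces, orthogonal with respect to this scalar product, with $\dim V_1 = n-1$ and $\dim V_2 = \binom{n-1}{2}$, such that the following hold, where $\mathrm{pr}_i$ denotes the orthogonal projection onto $V_i$ ($i=1,2$): (1) The image $\mathrm{pr}_1(P_n)$ of the $n$-th linear ordering polytope $P_n$ is (affinely isomorphic to) the $n$-th permutahedron $\Pi_n$. (2) The image $\mathrm{pr}_2(P_n)$ is (affinely isomorphic to) the $(n-1)$-st linear ordering polytope $P_{n-1}$. (3) Both projections are equivariant with respect to the $\mathbb{Z}_2\times S_n$-action on $P_n$. That is, the affine isomorphism $\varphi_1:\mathrm{pr}_1(P_n)\to\Pi_n$ in (1) can be chosen so that $\varphi_1\circ \mathrm{pr}_1: P_n\to \Pi_n$ is equivariant for the natural $\mathbb{Z}_2\times S_n$-actions on $P_n$ and $\Pi_n$; and, for an affine isomorphism $\varphi_2:\mathrm{pr}_2(P_n)\to P_{n-1}$ as in (2), there is an action of $\mathbb{Z}_2\times S_n$ on $P_{n-1}$ by affine automorphisms such that $\varphi_2\circ\mathrm{pr}_2:P_n\to P_{n-1}$ is equivariant.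
   Context: $S_n$ is the symmetric group on $\{1,\dots,n\}$, with product $\pi\tau$ meaning composition (first $\tau$, then $\pi$). For $\pi\in S_n$ and $1\le i<j\le n$ set $k_{ij}(\pi)=1$ if $\pi(i)>\pi(j)$ and $k_{ij}(\pi)=0$ if $\pi(i)<\pi(j)$. The $n$-th linear ordering polytope $P_n$ is the convex hull in $\mathbb{R}^{\binom n2}$ of the $n!$ vectors $p_\pi := (k_{ij}(\pi))_{1\le i<j\le n}$, $\pi\in S_n$ (for $n=1$ it is the single point $\mathbb{R}^0$). The $n$-th permutahedron $\Pi_n$ is the convex hull in $\mathbb{R}^n$ of the $n!$ points $q_\pi := (\pi(1),\dots,\pi(n))$, $\pi\in S_n$. Natural actions: $S_n$ acts on $P_n$ by affine automorphisms determined on vertices by $\sigma\cdot p_\tau = p_{\tau\sigma^{-1}}$ for $\sigma,\tau\in S_n$. Let $\omega_0\in S_n$ be the reversal permutation, $\omega_0(i)=n+1-i$; the generator of $\mathbb{Z}_2$ acts on $P_n$ by the affine automorphism determined by $p_\tau\mapsto p_{\omega_0\tau}$. These two actions commute and give a $\mathbb{Z}_2\times S_n$-action on $P_n$. Likewise $\mathbb{Z}_2\times S_n$ acts on $\Pi_n$ by affine automorphisms determined by $\sigma\cdot q_\tau=q_{\tau\sigma^{-1}}$ and, for the generator of $\mathbb{Z}_2$, $q_\tau\mapsto q_{\omega_0\tau}$. Polytopes are identified up to affine isomorphism: two polytopes are affinely isomorphic if there is an affine bijection between them (a bijection that is the restriction of an affine map between their affine hulls). *)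

(* Defs.v *)
From HB Require Import structures.
From mathcomp Require Import all_boot all_order all_fingroup all_algebra.
From mathcomp Require Import classical_sets functions reals.

Set Implicit Arguments.
Unset Strict Implicit.
Unset Printing Implicit Defensive.

Import Order.TTheory GRing.Theory Num.Theory.
Local Open Scope classical_set_scope.
Local Open Scope ring_scope.

Section ConvexAffine.
Variable R : realType.

Definition conv_hull (E : lmodType R) (A : set E) : set E :=
  [set y | exists (m : nat) (x : 'I_m -> E) (w : 'I_m -> R),
     [/\ forall i, A (x i), forall i, 0 <= w i, \sum_i w i = 1
       & y = \sum_i w i *: x i]].

Definition affine_hull (E : lmodType R) (A : set E) : set E :=
  [set y | exists (m : nat) (x : 'I_m -> E) (w : 'I_m -> R),
     [/\ forall i, A (x i), \sum_i w i = 1 & y = \sum_i w i *: x i]].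

Definition affine_on (E F : lmodType R) (D : set E) (f : E -> F) : Prop :=
  forall (m : nat) (x : 'I_m -> E) (w : 'I_m -> R),
    (forall i, D (x i)) -> \sum_i w i = 1 ->
    f (\sum_i w i *: x i) = \sum_i w i *: f (x i).

(* Maps between subsets of E and F are represented by total functions
   E -> F; here only the values of f on affine_hull A matter. *)
Definition affine_iso (E F : lmodType R) (A : set E) (B : set F)
    (f : E -> F) : Prop :=
  [/\ affine_on (affine_hull A) f,
      set_fun (affine_hull A) (affine_hull B) f
    & set_bij A B f].

Definition affinely_isomorphic (E F : lmodType R) (A : set E) (B : set F) :
    Prop :=
  exists f : E -> F, affine_iso A B f.

(* The law of {perm T} is (s * t) x = t (s x), so g * h reads "g, then h" and
   the last clause, applied to a group of permutations, says that a is a left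
   action for the usual composition of permutations. *)
Definition affine_action (gT : finGroupType) (E : lmodType R) (A : set E)
    (a : gT -> E -> E) : Prop :=
  [/\ forall g, affine_iso A A (a g),
      forall x, A x -> a 1%g x = x
    & forall g h x, A x -> a (g * h)%g x = a h (a g x)].

Definition equivariant (gT : finGroupType) (E F : lmodType R) (A : set E)
    (a : gT -> E -> E) (b : gT -> F -> F) (f : E -> F) : Prop :=
  forall g x, A x -> f (a g x) = b g (f x).

Definition orth_proj (E : vectType R) (dot : {dot E for idfun})
    (V : {vspace E}) (pr : 'End(E)) : Prop :=
  forall u, pr u \in V /\ forall v, v \in V -> dot (u - pr u) v = 0.

End ConvexAffine.

Definition pairs (n : nat) := {p : 'I_n * 'I_n | (p.1 < p.2)%N}.

(* Coordinate space of dimension 'C(n, 2), indexed by the pairs i < j. *)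
Definition pair_space (R : realType) (n : nat) : vectType R :=
  {ffun pairs n -> R^o}.

Definition lo_vertex (R : realType) (n : nat) (t : 'S_n) : pair_space R n :=
  [ffun p : pairs n => (t (val p).2 < t (val p).1)%N%:R].

Definition lo_polytope (R : realType) (n : nat) : set (pair_space R n) :=
  conv_hull (range (@lo_vertex R n)).

Arguments lo_vertex : clear implicits.
Arguments lo_polytope : clear implicits.

(* 'I_n is {0, ..., n - 1}, hence the shift by one. *)
Definition permutahedron_vertex (R : realType) (n : nat) (t : 'S_n) : 'rV[R]_n :=
  \row_i (t i).+1%:R.

Definition permutahedron (R : realType) (n : nat) : set 'rV[R]_n :=
  conv_hull (range (@permutahedron_vertex R n)).

Arguments permutahedron_vertex : clear implicits.
Arguments permutahedron : clear implicits.

Definition omega0 (n : nat) : 'S_n := perm (@rev_ord_inj n).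

(* For g = (e, s), this is the composite function omega0^e \o t \o s^-1
   (in {perm 'I_n} the factor written on the left is applied first). *)
Definition twist (n : nat) (g : 'Z_2 * 'S_n) (t : 'S_n) : 'S_n :=
  (g.2^-1 * t * omega0 n ^+ g.1)%g.

(* As an affine map is determined on the hull by its values on the v t, this
   characterizes a uniquely on conv_hull (range v). *)
Definition natural_action (R : realType) (n : nat) (E : lmodType R)
    (v : 'S_n -> E) (a : 'Z_2 * 'S_n -> E -> E) : Prop :=
  affine_action (conv_hull (range v)) a /\
  forall g t, a g (v t) = v (twist g t).

(* Main.v *)
(** Write a point of R^'C(n, 2) as a skew-symmetric matrix (x_ij), so that
    translating by 1/2 turns p_pi into half of sgn (pi(i) - pi(j)).
    For the standard scalar product the gradients (a_i - a_j) and the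
    matrices with zero row sums are orthogonal complements.  The row sums of
    p_pi are pi(i) up to an affine change, so projecting to the gradients gives
    the permutahedron.  The other projection only retains the curls
    x_ij + x_jk + x_ki, i.e. the cyclic order underlying pi; cutting this cyclic
    order at n gives a linear order on n - 1 elements, and every linear order
    arises in this way.

    An affine map between convex hulls of two families v and u indexed by the
    same set, sending v_t to u_t, exists iff every affine dependency of v is one
    of u.  Hence both isomorphisms and all actions only require
    comparing affine dependencies. *)

Require Import Defs.
From HB Require Import structures.
From mathcomp Require Import all_boot all_order all_fingroup all_algebra.
From mathcomp Require Import boolp classical_sets functions reals.
From mathcomp Require Import zify ring lra.

Set Implicit Arguments.
Unset Strict Implicit.
Unset Printing Implicit Defensive.

Import Order.TTheory GRing.Theory Num.Theory.
Local Open Scope classical_set_scope.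
Local Open Scope ring_scope.

(** * Affine maps and hulls of finite families of points *)

Section AffineDependencies.
Variable R : realType.

Lemma sum_enum_val (T : finType) (M : nmodType) (h : T -> M) :
  \sum_t h t = \sum_(i < #|T|) h (enum_val i).
Proof.
rewrite [LHS](reindex_onto enum_val enum_rank) => [|t _].
  by apply: eq_bigl => i; rewrite enum_valK eqxx.
exact: enum_rankK.
Qed.

Lemma sum_comb_reindex (T : finType) (E : lmodType R) (v : T -> E) (m : nat)
    (s : 'I_m -> T) (w : 'I_m -> R) :
  \sum_i w i *: v (s i) = \sum_t (\sum_(i | s i == t) w i) *: v t.
Proof.
rewrite (partition_big s xpredT) //=; apply: eq_bigr => t _.
by rewrite scaler_suml; apply: eq_bigr => i /eqP ->.
Qed.

Lemma sum_weight_reindex (T : finType) (m : nat) (s : 'I_m -> T)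
    (w : 'I_m -> R) :
  \sum_i w i = \sum_t \sum_(i | s i == t) w i.
Proof. by rewrite (partition_big s xpredT). Qed.

Lemma sum_comb_comb (T : finType) (E : lmodType R) (v : T -> E) (m : nat)
    (w : 'I_m -> R) (c : 'I_m -> T -> R) :
  \sum_i w i *: (\sum_t c i t *: v t) = \sum_t (\sum_i w i * c i t) *: v t.
Proof.
under eq_bigr do rewrite scaler_sumr.
rewrite exchange_big; apply: eq_bigr => t _; rewrite scaler_suml.
by apply: eq_bigr => i _; rewrite scalerA.
Qed.

Lemma sum_weight_comb (T : finType) (m : nat) (w : 'I_m -> R)
    (c : 'I_m -> T -> R) :
  (forall i, \sum_t c i t = 1) -> \sum_i w i = 1 ->
  \sum_t (\sum_i w i * c i t) = 1.
Proof.
move=> c1 w1; rewrite exchange_big /= -[RHS]w1; apply: eq_bigr => i _.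
by rewrite -mulr_sumr c1 mulr1.
Qed.

Lemma range_index (T E : Type) (v : T -> E) (m : nat) (x : 'I_m -> E) :
  (forall i, range v (x i)) -> exists s : 'I_m -> T, x = v \o s.
Proof.
move=> xv; have /choice[s sP] : forall i, exists t, v t = x i.
  by move=> i; have [t _ <-] := xv i; exists t.
by exists s; apply/funext => i /=; rewrite sP.
Qed.

(** Combinations of any length, with points repeated, reduce to one coefficient per index by adding
    up the weights of equal indices. *)
Lemma affine_hull_rangeP (T : finType) (E : lmodType R) (v : T -> E) (y : E) :
  affine_hull (range v) y <->
  exists2 c : T -> R, \sum_t c t = 1 & y = \sum_t c t *: v t.
Proof.
split=> [[m [x [w [/range_index[s ->] w1 ->]]]]|[c c1 ->]].
  exists (fun t => \sum_(i | s i == t) w i);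
    last exact: (sum_comb_reindex v s w).
  by rewrite -sum_weight_reindex.
exists #|T|, (v \o enum_val), (c \o enum_val); split=> [i||] /=.
- by exists (enum_val i).
- by rewrite -sum_enum_val.
- exact: sum_enum_val.
Qed.

Lemma conv_hull_rangeP (T : finType) (E : lmodType R) (v : T -> E) (y : E) :
  conv_hull (range v) y <->
  exists c : T -> R, [/\ forall t, 0 <= c t, \sum_t c t = 1
                       & y = \sum_t c t *: v t].
Proof.
split=> [[m [x [w [/range_index[s ->] w0 w1 ->]]]]|[c [c0 c1 ->]]].
  exists (fun t => \sum_(i | s i == t) w i); split=> [t||].
  - exact: sumr_ge0.
  - by rewrite -sum_weight_reindex.
  - exact: (sum_comb_reindex v s w).
exists #|T|, (v \o enum_val), (c \o enum_val); split=> [i|i||] //=.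
- by exists (enum_val i).
- by rewrite -sum_enum_val.
- exact: sum_enum_val.
Qed.

Lemma conv_hull_sub_affine (E : lmodType R) (A : set E) :
  conv_hull A `<=` affine_hull A.
Proof. by move=> y [m [x [w [xA _ w1 ->]]]]; exists m, x, w. Qed.

Lemma sub_conv_hull (E : lmodType R) (A : set E) : A `<=` conv_hull A.
Proof.
move=> y Ay; exists 1%N, (fun=> y), (fun=> 1); split=> //; rewrite big_ord1 //.
by rewrite scale1r.
Qed.

Lemma affine_hull_comb (T : finType) (E : lmodType R) (v : T -> E) (m : nat)
    (x : 'I_m -> E) (w : 'I_m -> R) :
  (forall i, affine_hull (range v) (x i)) -> \sum_i w i = 1 ->
  affine_hull (range v) (\sum_i w i *: x i).
Proof.
move=> xv w1; have /choice[c cP] : forall i, exists c : T -> R,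
    \sum_t c t = 1 /\ x i = \sum_t c t *: v t.
  by move=> i; have /affine_hull_rangeP[c] := xv i; exists c.
apply/affine_hull_rangeP; exists (fun t => \sum_i w i * c i t).
  by apply: sum_weight_comb => // i; case: (cP i).
by rewrite -sum_comb_comb; apply: eq_bigr => i _; case: (cP i) => _ <-.
Qed.

Lemma affine_hull_conv_hull (T : finType) (E : lmodType R) (v : T -> E) :
  affine_hull (conv_hull (range v)) = affine_hull (range v).
Proof.
apply/seteqP; split=> y [m [x [w [xA w1 ->]]]].
  by apply: affine_hull_comb => // i; apply: conv_hull_sub_affine; apply: xA.
by exists m, x, w; split=> // i; apply: sub_conv_hull; apply: xA.
Qed.

Lemma affine_on_sum (T : finType) (E F : lmodType R) (D : set E) (x : T -> E)
    (f : E -> F) (c : T -> R) :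
  affine_on D f -> (forall t, D (x t)) -> \sum_t c t = 1 ->
  f (\sum_t c t *: x t) = \sum_t c t *: f (x t).
Proof.
move=> fA xD c1; rewrite sum_enum_val fA -?(sum_enum_val c) //.
by rewrite -(sum_enum_val (fun t => c t *: f (x t))).
Qed.

Lemma mem_affine_hull_range (T : Type) (E : lmodType R) (v : T -> E) (t : T) :
  affine_hull (range v) (v t).
Proof. by apply: conv_hull_sub_affine; apply: sub_conv_hull; exists t. Qed.

Lemma affine_on_comb (T : finType) (E F : lmodType R) (v : T -> E) (f : E -> F)
    (c : T -> R) :
  affine_on (affine_hull (range v)) f -> \sum_t c t = 1 ->
  f (\sum_t c t *: v t) = \sum_t c t *: f (v t).
Proof. by move=> fA; apply: affine_on_sum fA (mem_affine_hull_range v). Qed.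

Lemma linear_affine_on (E F : lmodType R) (D : set E) (f : {linear E -> F}) :
  affine_on D f.
Proof.
by move=> m x w _ _; rewrite linear_sum; apply: eq_bigr => i _; rewrite linearZ.
Qed.

Lemma sum_delta (T : finType) (E : lmodType R) (v : T -> E) (t : T) :
  \sum_t' (t' == t)%:R *: v t' = v t.
Proof.
rewrite (bigD1 t) //= eqxx scale1r big1 ?addr0 // => t' /negPf ->.
exact: scale0r.
Qed.

Lemma sum_weight_delta (T : finType) (t : T) : \sum_t' (t' == t)%:R = 1 :> R.
Proof. by rewrite (bigD1 t) //= eqxx big1 ?addr0 // => t' /negPf ->. Qed.

Definition affine_dep (T : finType) (E : lmodType R) (v : T -> E)
    (c : T -> R) : Prop :=
  \sum_t c t = 0 /\ \sum_t c t *: v t = 0.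

Lemma affine_dep_sub (T : finType) (E : lmodType R) (v : T -> E)
    (c d : T -> R) :
  \sum_t c t = 1 -> \sum_t d t = 1 -> \sum_t c t *: v t = \sum_t d t *: v t ->
  affine_dep v (fun t => c t - d t).
Proof.
move=> c1 d1 cd; split; first by rewrite sumrB c1 d1 subrr.
by under eq_bigr do rewrite scalerBl; rewrite sumrB cd subrr.
Qed.

Lemma sum_sub_eq0 (T : finType) (E : lmodType R) (v : T -> E) (c d : T -> R) :
  \sum_t (c t - d t) *: v t = 0 -> \sum_t c t *: v t = \sum_t d t *: v t.
Proof.
by move=> e; apply/eqP; rewrite -subr_eq0 -sumrB; under eq_bigr do
  rewrite -scalerBl; rewrite e.
Qed.

(** The value at a point is read off from an arbitrary representation of it. Two representations
    differ by a dependency of [v], hence of [u], so the choice does not matter. Off the affine hull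
    [xget] returns the default 0. *)
Lemma affine_extension (T : finType) (E F : lmodType R) (v : T -> E)
    (u : T -> F) :
  (forall c, affine_dep v c -> affine_dep u c) ->
  exists f : E -> F,
    affine_on (affine_hull (range v)) f /\ forall t, f (v t) = u t.
Proof.
move=> vu.
pose val_at y := [set z | exists c : T -> R,
  [/\ \sum_t c t = 1, y = \sum_t c t *: v t & z = \sum_t c t *: u t]].
pose f y := xget 0 (val_at y).
have fE c : \sum_t c t = 1 -> f (\sum_t c t *: v t) = \sum_t c t *: u t.
  move=> c1; have [d [d1 vd ->]] : val_at (\sum_t c t *: v t)
      (f (\sum_t c t *: v t)) by apply: xgetPex; exists (\sum_t c t *: u t), c.
  by apply: sum_sub_eq0; have [] := vu _ (affine_dep_sub d1 c1 (esym vd)).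
exists f; split=> [m x w xv w1|t].
  have /choice[c cP] : forall i, exists c : T -> R,
      \sum_t c t = 1 /\ x i = \sum_t c t *: v t.
    by move=> i; have /affine_hull_rangeP[c] := xv i; exists c.
  have xE i : x i = \sum_t c i t *: v t by case: (cP i).
  have c1 i : \sum_t c i t = 1 by case: (cP i).
  under eq_bigr do rewrite xE.
  rewrite sum_comb_comb fE; last exact: sum_weight_comb.
  by rewrite -sum_comb_comb; apply: eq_bigr => i _; rewrite xE fE.
by rewrite -[v t](sum_delta v) fE ?sum_delta // sum_weight_delta.
Qed.

Lemma image_conv_hull (T : finType) (E F : lmodType R) (v : T -> E)
    (f : E -> F) :
  affine_on (affine_hull (range v)) f ->
  f @` conv_hull (range v) = conv_hull (range (f \o v)).
Proof.
move=> fA; apply/seteqP; split=> [y [x /conv_hull_rangeP[c [c0 c1 ->]] <-]|y].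
  by apply/conv_hull_rangeP; exists c; split; rewrite ?affine_on_comb.
move=> /conv_hull_rangeP[c [c0 c1 ->]]; exists (\sum_t c t *: v t).
  by apply/conv_hull_rangeP; exists c.
by rewrite affine_on_comb.
Qed.

Lemma affine_on_dep (T : finType) (E F : lmodType R) (D : set E) (v : T -> E)
    (f : E -> F) (c : T -> R) :
  affine_on D f -> (forall t, D (v t)) ->
  affine_dep v c -> affine_dep (f \o v) c.
Proof.
move=> fA vD [c0 cv]; split=> //.
have [t0 _|T0] := pickP (@predT T); last by apply: big_pred0.
(* An affine map only respects combinations of weight 1, so the coefficient at [t0] is raised by 1;
   the extra term [f (v t0)] cancels at the end. *)
pose d t := c t + (t == t0)%:R.
have d1 : \sum_t d t = 1 by rewrite big_split /= c0 sum_weight_delta add0r.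
have dE (G : lmodType R) (h : T -> G) :
    \sum_t d t *: h t = \sum_t c t *: h t + h t0.
  rewrite -[X in _ = _ + X](sum_delta h) -big_split; apply: eq_bigr => t _.
  exact: scalerDl.
have := affine_on_sum fA vD d1.
rewrite dE cv add0r (dE _ (fun t => f (v t))) -{1}[f _]add0r.
by move/addIr.
Qed.

(** For injectivity, two combinations of weight 1 with equal images differ by a dependency of
    [f \o v], hence of [v]. *)
Lemma affine_isoP (T : finType) (E F : lmodType R) (v : T -> E) (f : E -> F) :
  affine_on (affine_hull (range v)) f ->
  (forall c, affine_dep (f \o v) c -> affine_dep v c) ->
  affine_iso (conv_hull (range v)) (conv_hull (range (f \o v))) f.
Proof.
move=> fA fv; rewrite /affine_iso !affine_hull_conv_hull; split=> //.
  move=> y /affine_hull_rangeP[c c1 ->]; apply/affine_hull_rangeP.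
  by exists c; rewrite // affine_on_comb.
rewrite -image_conv_hull //; split=> [y ?|y z|//]; first by exists y.
rewrite !inE => /conv_hull_rangeP[c [c0 c1 ->]] /conv_hull_rangeP[d [d0 d1 ->]].
rewrite !affine_on_comb // => e; apply: sum_sub_eq0.
by have [] := fv _ (affine_dep_sub c1 d1 e).
Qed.

(* Splitting c into positive and negative parts of common mass s turns an
   affine dependency into the equality of two points of the convex hull. *)
Lemma affine_iso_dep (T : finType) (E F : lmodType R) (v : T -> E) (B : set F)
    (f : E -> F) (c : T -> R) :
  affine_iso (conv_hull (range v)) B f ->
  affine_dep (f \o v) c -> affine_dep v c.
Proof.
rewrite /affine_iso affine_hull_conv_hull => -[fA _ [_ finj _]] [c0 fc0].
split=> //; pose p t := Num.max (c t) 0; pose q t := Num.max (- c t) 0.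
have p0 t : 0 <= p t by rewrite /p le_max lexx orbT.
have q0 t : 0 <= q t by rewrite /q le_max lexx orbT.
have cE t : c t = p t - q t.
  rewrite /p /q; case: (leP (c t) 0) => h; case: (leP (- c t) 0) => h'.
  - by rewrite subr0; apply/eqP; rewrite eq_le h -oppr_le0 h'.
  - by rewrite sub0r opprK.
  - by rewrite subr0.
  - by move: h'; rewrite oppr_gt0 ltNge (ltW h).
pose s := \sum_t p t.
have sq : \sum_t q t = s.
  by apply/eqP; rewrite eq_sym -subr_eq0 -sumrB;
    rewrite -(eq_bigr _ (fun t _ => cE t)) c0.
have [s0|s0] := eqVneq s 0.
  have c00 t : c t = 0.
    have /eqP : s = 0 by []; rewrite psumr_eq0 // => /allP/(_ t).
    rewrite mem_index_enum => /(_ isT)/eqP pt.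
    move: sq; rewrite s0 => /eqP; rewrite psumr_eq0 // => /allP/(_ t).
    by rewrite mem_index_enum cE pt => /(_ isT)/eqP ->; rewrite subrr.
  by rewrite big1 // => t _; rewrite c00 scale0r.
have sp : 0 < s by rewrite lt_def s0 sumr_ge0.
pose P t := s^-1 * p t; pose Q t := s^-1 * q t.
have P1 : \sum_t P t = 1 by rewrite -mulr_sumr mulVf.
have Q1 : \sum_t Q t = 1 by rewrite -mulr_sumr sq mulVf.
have hull (r : T -> R) : (forall t, 0 <= r t) -> \sum_t s^-1 * r t = 1 ->
    \sum_t (s^-1 * r t) *: v t \in conv_hull (range v).
  move=> r0 r1; rewrite inE; apply/conv_hull_rangeP.
  by exists (fun t => s^-1 * r t); split=> // t;
    rewrite mulr_ge0 ?invr_ge0 ?(ltW sp).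
have split_c (G : lmodType R) (h : T -> G) :
    \sum_t P t *: h t - \sum_t Q t *: h t = s^-1 *: \sum_t c t *: h t.
  rewrite -sumrB scaler_sumr; apply: eq_bigr => t _.
  by rewrite -scalerBl -mulrBr -cE scalerA.
have PQ : \sum_t P t *: v t = \sum_t Q t *: v t.
  apply: finj; rewrite ?hull // !affine_on_comb //.
  by apply/eqP; rewrite -subr_eq0 (split_c _ (f \o v)) fc0 scaler0.
apply: (scalerI (invr_neq0 s0)).
by rewrite -split_c PQ subrr scaler0.
Qed.

(** Each [act g] preserves dependencies and so extends affinely from the vertices; the extension is
    injective because the inverse of [g] preserves dependencies too. *)
Lemma affine_action_exists (T : finType) (gT : finGroupType) (E : lmodType R)
    (v : T -> E) (act : gT -> T -> T) :
  (forall t, act 1%g t = t) ->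
  (forall g h t, act (g * h)%g t = act h (act g t)) ->
  (forall g c, affine_dep v c -> affine_dep (v \o act g) c) ->
  exists a : gT -> E -> E,
    affine_action (conv_hull (range v)) a /\
    forall g t, a g (v t) = v (act g t).
Proof.
move=> act1 actM depv.
have /choice[a aP] : forall g, exists f : E -> E,
    affine_on (affine_hull (range v)) f /\ forall t, f (v t) = v (act g t).
  by move=> g; apply: affine_extension => c; apply: depv.
have aA g : affine_on (affine_hull (range v)) (a g) by case: (aP g).
have aE g t : a g (v t) = v (act g t) by case: (aP g).
have avE g : a g \o v = v \o act g by apply/funext => t /=; rewrite aE.
have actK g : cancel (act g) (act g^-1%g).
  by move=> t; rewrite -actM mulgV act1.
have actKV g : cancel (act g^-1%g) (act g).
  by move=> t; rewrite -actM mulVg act1.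
have rangeE g : range (v \o act g) = range v.
  apply/seteqP; split=> y [t _ <-]; first by exists (act g t).
  by exists (act g^-1%g t) => //=; rewrite actKV.
exists a; split=> //; split=> [g|x /conv_hull_rangeP[c [_ c1 ->]]|].
- rewrite -[X in affine_iso _ (conv_hull X)](rangeE g) -avE.
  apply: affine_isoP => // c; rewrite avE => -[c0 cv].
  have act_inj := can_inj (actK g).
  have [|_] := depv g^-1%g (c \o act g^-1%g).
    by split; rewrite (reindex_inj act_inj) /=; under eq_bigr do rewrite actK.
  rewrite (reindex_inj act_inj) /=; under eq_bigr do rewrite actK.
  by split.
- by rewrite affine_on_comb //; apply: eq_bigr => t _; rewrite aE act1.
- move=> g h x /conv_hull_rangeP[c [_ c1 ->]].
  rewrite affine_on_comb // [a g _]affine_on_comb //.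
  have -> : \sum_t c t *: a g (v t) = \sum_t c t *: (v \o act g) t.
    by apply: eq_bigr => t _; rewrite aE.
  rewrite affine_on_comb ?rangeE //.
  by apply: eq_bigr => t _; rewrite /= !aE actM.
Qed.

(** Both sides are affine in [x], so it suffices to compare them at the vertices. *)
Lemma equivariant_of_vertices (T : finType) (gT : finGroupType)
    (E F : lmodType R) (v : T -> E) (act : gT -> T -> T) (a : gT -> E -> E)
    (b : gT -> F -> F) (f : E -> F) :
  affine_on (affine_hull (range v)) f ->
  affine_action (conv_hull (range v)) a ->
  affine_action (conv_hull (range (f \o v))) b ->
  (forall g t, a g (v t) = v (act g t)) ->
  (forall g t, b g (f (v t)) = f (v (act g t))) ->
  equivariant (conv_hull (range v)) a b f.
Proof.
move=> fA [aA _ _] [bA _ _] av bv g x /conv_hull_rangeP[c [_ c1 ->]].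
have [agA _ _] := aA g; have [bgA _ _] := bA g.
rewrite !affine_hull_conv_hull in agA bgA.
rewrite (affine_on_comb agA c1) (affine_on_comb fA c1).
rewrite (affine_on_comb (v := f \o v) bgA c1).
rewrite (affine_on_sum fA _ c1) => [|t]; last first.
  by rewrite av; apply: mem_affine_hull_range.
by apply: eq_bigr => t _ /=; rewrite av bv.
Qed.

End AffineDependencies.

(** * Sums over pairs of indices and their number *)

Lemma sum_pairs (M : nmodType) (n : nat) (h : 'I_n -> 'I_n -> M) :
  (forall i, h i i = 0) ->
  \sum_i \sum_j h i j =
  \sum_(p : pairs n) (h (val p).1 (val p).2 + h (val p).2 (val p).1).
Proof.
move=> h0; rewrite pair_big /= (bigID (fun p : 'I_n * 'I_n => p.1 < p.2)%N) /=.
rewrite big_split /=; congr (_ + _).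
  rewrite (reindex_omap (val : pairs n -> _) insub) => [|p lt_p].
    by apply: eq_bigl => p; rewrite valK (valP p) eqxx.
  by rewrite insubT.
rewrite (bigID (fun p : 'I_n * 'I_n => p.1 == p.2)) /= big1 ?add0r; last first.
  by move=> [i j] /= /andP[_ /eqP <-].
rewrite (reindex_omap (fun p : pairs n => ((val p).2, (val p).1))
  (fun q => insub (q.2, q.1))) => [|[i j] /=].
  apply: eq_bigl => p /=; rewrite -surjective_pairing valK eqxx andbT.
  by have := valP p; rewrite /= -(inj_eq val_inj) /= -leqNgt; lia.
rewrite -leqNgt -(inj_eq val_inj) /= => /andP[le_ji ne_ij].
by rewrite insubT //=; lia.
Qed.

Lemma sum_ltn n (k : 'I_n) : (\sum_(j < n) (j < k) = k)%N.
Proof.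
rewrite -(big_mkord xpredT (fun i : nat => (i < k)%N : nat)) /=.
rewrite (big_cat_nat (n := k)) //= 1?ltnW //.
rewrite [X in (_ + X)%N]big_nat_cond [X in (_ + X)%N]big1 ?addn0; last first.
  by move=> i /andP[/andP[le_ki _] _]; rewrite ltnNge le_ki.
under eq_big_nat => i /andP[_ ->] do [].
by rewrite sum_nat_const_nat subn0 muln1.
Qed.

(** In the indicator matrix of i < j, column j contains j ones, and 0 + ... + (n - 1) = C(n, 2). *)
Lemma card_pairs (n : nat) : #|{: pairs n}| = 'C(n, 2).
Proof.
pose h (i j : 'I_n) : nat := (i < j)%N.
have -> : #|{: pairs n}| = (\sum_i \sum_j h i j)%N.
  rewrite sum_pairs /h => [|i]; last by rewrite ltnn.
  rewrite -sum1_card; apply: eq_bigr => p _.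
  by have := valP p; rewrite /= => lt_p; rewrite lt_p ltnNge (ltnW lt_p).
rewrite exchange_big -bin2_sum big_mkord; apply: eq_bigr => j _ /=.
exact: sum_ltn.
Qed.

(** * Skew-symmetric matrices: gradient, divergence and scalar product *)

Section PairSpace.
Variables (R : realType) (n : nat).
Implicit Types (x y : pair_space R n) (i j k : 'I_n) (p : pairs n).

(* The coordinates of x as the upper triangle of a skew-symmetric matrix. *)
Definition entry i j x : R :=
  if insub (i, j) is Some p then x p
  else if insub (j, i) is Some p then - x p else 0.

Lemma entry_pair p x : entry (val p).1 (val p).2 x = x p.
Proof. by rewrite /entry -surjective_pairing valK. Qed.

Lemma entryC i j x : entry i j x = - entry j i x.
Proof.
rewrite /entry; case: insubP => [p /= lt_ij _|/= ge_ij]; last first.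
  by case: insubP => [q _ _|_]; rewrite ?opprK ?oppr0.
by case: insubP => [q /= lt_ji _|/= _]; [lia | rewrite opprK].
Qed.

Lemma entryxx i x : entry i i x = 0.
Proof. by have := entryC i i x; lra. Qed.

Lemma entry_linear i j : linear (entry i j : pair_space R n -> R^o).
Proof.
move=> a x y; rewrite /entry; case: insubP => [p _ _|_].
  by rewrite !ffunE.
case: insubP => [p _ _|_]; first by rewrite !ffunE opprD scalerN.
by rewrite scaler0 addr0.
Qed.

HB.instance Definition _ i j :=
  GRing.isLinear.Build R (pair_space R n) R^o _ (entry i j : _ -> R^o)
    (entry_linear i j).

Lemma eq_entry x y : (forall i j, entry i j x = entry i j y) -> x = y.
Proof. by move=> xy; apply/ffunP => p; rewrite -!entry_pair. Qed.

Definition grad (a : 'I_n -> R) : pair_space R n :=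
  [ffun p => a (val p).1 - a (val p).2].

Lemma entry_grad i j a : entry i j (grad a) = a i - a j.
Proof.
rewrite /entry; case: insubP => [p _ pE|/= ge_ij].
  by rewrite ffunE pE.
case: insubP => [p _ pE|/= ge_ji].
  by rewrite ffunE pE opprB.
have -> : i = j by apply: val_inj => /=; lia.
by rewrite subrr.
Qed.

Definition div i x : R := \sum_j entry i j x.

Lemma div_linear i : linear (div i : pair_space R n -> R^o).
Proof.
move=> a x y; rewrite /div scaler_sumr -big_split /=.
by apply: eq_bigr => j _; rewrite linearP.
Qed.

HB.instance Definition _ i :=
  GRing.isLinear.Build R (pair_space R n) R^o _ (div i : _ -> R^o)
    (div_linear i).

Lemma sum_div x : \sum_i div i x = 0.
Proof.
have : \sum_i div i x = - \sum_i div i x; last by lra.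
rewrite [LHS]exchange_big -sumrN; apply: eq_bigr => i _.
by rewrite -sumrN; apply: eq_bigr => j _; rewrite entryC.
Qed.

Definition pair_dot x y : R := \sum_p x p * y p.

(** Summation by parts: the terms a_i y_ij and a_j y_ji combine to (a_i - a_j) y_ij. Thus [div] is
    adjoint to [grad], which makes gradients orthogonal to matrices with zero row sums. *)
Lemma pair_dot_grad a y : pair_dot (grad a) y = \sum_i a i * div i y.
Proof.
under [RHS]eq_bigr do rewrite mulr_sumr.
rewrite sum_pairs => [|i]; last by rewrite entryxx mulr0.
by apply: eq_bigr => p _; rewrite [entry _.2 _ _]entryC entry_pair ffunE; ring.
Qed.

Lemma pair_dotC x y : pair_dot x y = pair_dot y x.
Proof. by apply: eq_bigr => p _; rewrite mulrC. Qed.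

Lemma pair_dot_bilinear : bilinear_for *%R (idfun \; *%R) pair_dot.
Proof.
split=> [y a x x'|x a y y'] /=; rewrite /pair_dot mulr_sumr -big_split;
  by apply: eq_bigr => p _; rewrite !ffunE /= /GRing.scale /=; ring.
Qed.

Lemma pair_dot_gt0 x : x != 0 -> 0 < pair_dot x x.
Proof.
move=> x0; rewrite lt_def sumr_ge0 ?andbT => [|p _]; last first.
  by rewrite -expr2 sqr_ge0.
apply: contraNneq x0 => xx0; apply/eqP/ffunP => p; rewrite ffunE; apply/eqP.
move: xx0 => /eqP; rewrite psumr_eq0 => [/allP/(_ p)|q _]; last first.
  by rewrite -expr2 sqr_ge0.
by rewrite mem_index_enum mulf_eq0 orbb => /(_ isT).
Qed.

HB.instance Definition _ :=
  bilinear_isBilinear.Build R (pair_space R n) (pair_space R n) R _ _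
    pair_dot pair_dot_bilinear.

Lemma pair_dot_hermitian x y :
  pair_dot x y = (-1) ^+ false * idfun (pair_dot y x).
Proof. by rewrite mul1r pair_dotC. Qed.

HB.instance Definition _ :=
  isHermitianSesquilinear.Build R (pair_space R n) false idfun pair_dot
    pair_dot_hermitian.
HB.instance Definition _ :=
  isDotProduct.Build R (pair_space R n) pair_dot pair_dot_gt0.

End PairSpace.

(** * Orthogonal decomposition into gradients and divergence-free matrices *)

Section Decomposition.
Variable R : realType.

Lemma entry_ffun n (h : 'I_n -> 'I_n -> R) (i j : 'I_n) : (i < j)%N ->
  entry i j ([ffun p => h (val p).1 (val p).2] : pair_space R n) = h i j.
Proof.
move=> lt_ij; rewrite /entry; case: insubP => [p _ pE|/=].
  by rewrite ffunE pE.
by rewrite lt_ij.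
Qed.

Lemma dim_pair_space n : \dim {: pair_space R n} = 'C(n, 2).
Proof. by rewrite dimvf /dim /= card_pairs muln1. Qed.

Lemma div_grad n (i : 'I_n) (a : 'I_n -> R) :
  div i (grad a) = n%:R * a i - \sum_j a j.
Proof.
rewrite /div; under eq_bigr do rewrite entry_grad.
by rewrite sumrB sumr_const card_ord mulr_natl.
Qed.

(** The potential [div i x] / n has sum zero, so by [div_grad] its gradient has the same row sums as
    [x]. *)
Definition grad_part n (x : pair_space R n) : pair_space R n :=
  grad (fun i => n%:R^-1 * div i x).

Lemma grad_part_linear n : linear (@grad_part n).
Proof.
move=> a x y; apply/ffunP => p; rewrite !ffunE !linearP /= /GRing.scale /=.
by ring.
Qed.

HB.instance Definition _ n :=
  GRing.isLinear.Build R (pair_space R n) (pair_space R n) _ (@grad_part n)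
    (@grad_part_linear n).

Lemma div_grad_part n (i : 'I_n) x : div i (grad_part x) = div i x.
Proof.
have n0 : n%:R != 0 :> R.
  by rewrite pnatr_eq0 -lt0n (leq_ltn_trans _ (ltn_ord i)).
by rewrite div_grad -mulr_sumr sum_div mulr0 subr0 mulVKf.
Qed.

Lemma grad_part_eq0 n (x : pair_space R n) :
  grad_part x = 0 <-> forall i, div i x = 0.
Proof.
split=> [x0 i|x0]; first by rewrite -div_grad_part x0 linear0.
by apply/ffunP => p; rewrite !ffunE !x0 subrr.
Qed.

(** The recovered potential is [a] minus its mean, and constants have zero gradient. *)
Lemma grad_part_grad n (a : 'I_n -> R) : grad_part (grad a) = grad a.
Proof.
apply/ffunP => p; rewrite !ffunE !div_grad.
have n0 : n%:R != 0 :> R.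
  by rewrite pnatr_eq0 -lt0n (leq_ltn_trans _ (ltn_ord (val p).1)).
by field.
Qed.

(* The circulation of x around the triangle i, j, n; at the vertex of a linear
   order it only depends on the underlying cyclic order. *)
Definition curl m (x : pair_space R m.+1) : pair_space R m :=
  [ffun p : pairs m => let i := lift ord_max (val p).1 in
     let j := lift ord_max (val p).2 in
     entry i j x + entry j ord_max x + entry ord_max i x].

Lemma curl_linear m : linear (@curl m).
Proof.
move=> a x y; apply/ffunP => p; rewrite !ffunE /= !linearP /= /GRing.scale /=.
by ring.
Qed.

HB.instance Definition _ m :=
  GRing.isLinear.Build R (pair_space R m.+1) (pair_space R m) _ (@curl m)
    (@curl_linear m).

Lemma curl_grad m (a : 'I_m.+1 -> R) : curl (grad a) = 0.
Proof. by apply/ffunP => p; rewrite !ffunE /= !entry_grad; ring. Qed.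

(** Vanishing circulation around i, j, n reads x_ij = x_in - x_jn, so the last column is a
    potential. *)
Lemma curl_eq0 m (x : pair_space R m.+1) :
  curl x = 0 -> x = grad (fun i => entry i ord_max x).
Proof.
move=> x0; apply/ffunP => p; rewrite ffunE -entry_pair.
case: p => -[i j] /= lt_ij.
case: (unliftP ord_max j) lt_ij => [j' ->|-> _]; last by rewrite entryxx subr0.
case: (unliftP ord_max i) => [i' ->|->]; last first.
  by have := ltn_ord (lift ord_max j'); rewrite /=; lia.
rewrite !lift_max => lt_ij; move/ffunP/(_ (exist _ (i', j') lt_ij)): x0.
rewrite !ffunE /= [entry ord_max _ _]entryC => e.
by apply/eqP; rewrite eq_sym subr_eq eq_sym -subr_eq0 e.
Qed.

(** When [y] is extended by a zero last row and column, only the entry y_ij remains in the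
    circulation around i, j, n. *)
Lemma curl_surj m (y : pair_space R m) : exists x, curl x = y.
Proof.
pose h (i j : 'I_m.+1) : R :=
  if (unlift ord_max i, unlift ord_max j) is (Some i', Some j')
  then entry i' j' y else 0.
exists [ffun p => h (val p).1 (val p).2].
apply/ffunP => p; rewrite ffunE /= [entry ord_max _ _]entryC.
have lt_max (i : 'I_m) : (lift ord_max i < (ord_max : 'I_m.+1))%N.
  by rewrite lift_max /=.
rewrite !entry_ffun ?lt_max //; last by rewrite !lift_max (valP p).
by rewrite /h !liftK unlift_none subr0 addr0 entry_pair.
Qed.

(** As a kernel, V_1 gets its dimension from rank and nullity of [curl]; [cocyclesP] identifies it
    with the space of gradients. *)
Definition cocycles m : {vspace pair_space R m.+1} := lker (linfun (@curl m)).
Definition pr_grad m : 'End(pair_space R m.+1) := linfun (@grad_part m.+1).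
Definition divfree m : {vspace pair_space R m.+1} := lker (pr_grad m).

Definition pr_divfree m : 'End(pair_space R m.+1) := \1%VF - pr_grad m.

Lemma pr_divfreeE m (x : pair_space R m.+1) : pr_divfree m x = x - pr_grad m x.
Proof. by rewrite !lfun_simp. Qed.

Lemma cocyclesP m (x : pair_space R m.+1) :
  reflect (exists a, x = grad a) (x \in cocycles m).
Proof.
rewrite memv_ker lfunE /=; apply: (iffP eqP) => [/curl_eq0 ->|[a ->]].
  by eexists.
exact: curl_grad.
Qed.

Lemma divfreeP m (x : pair_space R m.+1) :
  reflect (forall i, div i x = 0) (x \in divfree m).
Proof. by rewrite memv_ker lfunE /=; apply: (iffP eqP) => /grad_part_eq0. Qed.

Lemma cocycles_orthogonal m (u v : pair_space R m.+1) :
  u \in cocycles m -> v \in divfree m -> pair_dot u v = 0.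
Proof.
move=> /cocyclesP[a ->] /divfreeP v0; rewrite pair_dot_grad big1 // => i _.
by rewrite v0 mulr0.
Qed.

Lemma pr_grad_cocycles m (x : pair_space R m.+1) : pr_grad m x \in cocycles m.
Proof. by apply/cocyclesP; rewrite lfunE; eexists. Qed.

Lemma sub_pr_grad_divfree m (x : pair_space R m.+1) :
  x - pr_grad m x \in divfree m.
Proof.
by apply/divfreeP => i; rewrite lfunE raddfB /= div_grad_part subrr.
Qed.

Lemma pr_grad_orth_proj m :
  orth_proj (@pair_dot R m.+1) (cocycles m) (pr_grad m).
Proof.
move=> u; split=> [|v vV]; first exact: pr_grad_cocycles.
by rewrite /= pair_dotC cocycles_orthogonal ?sub_pr_grad_divfree.
Qed.

Lemma pr_divfree_orth_proj m :
  orth_proj (@pair_dot R m.+1) (divfree m) (pr_divfree m).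
Proof.
move=> u; rewrite pr_divfreeE; split=> [|v vV]; first exact: sub_pr_grad_divfree.
by rewrite /= opprB addrC subrK cocycles_orthogonal ?pr_grad_cocycles.
Qed.

Lemma cocycles_add_divfree m : (cocycles m + divfree m)%VS = fullv.
Proof.
apply/vspaceP => x; rewrite memvf; apply/memv_addP.
exists (pr_grad m x); first exact: pr_grad_cocycles.
by exists (x - pr_grad m x); rewrite ?sub_pr_grad_divfree // addrC subrK.
Qed.

Lemma cocycles_cap_divfree m : (cocycles m :&: divfree m)%VS = 0%VS.
Proof.
apply/eqP; rewrite -subv0; apply/subvP => x.
rewrite memv_cap memv0 => /andP[/cocyclesP[a ->]].
by rewrite memv_ker lfunE /= grad_part_grad.
Qed.

(** Rank and nullity for the surjective [curl], with Pascal's rule C(m + 1, 2) = C(m, 2) + m. *)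
Lemma dim_cocycles m : \dim (cocycles m) = m.
Proof.
have := limg_ker_dim (linfun (@curl m)) fullv.
have -> : limg (linfun (@curl m)) = fullv.
  apply/vspaceP => y; rewrite memvf; have [x <-] := curl_surj y.
  by apply/memv_imgP; exists x; rewrite ?memvf // lfunE.
rewrite capfv !dim_pair_space binS bin1 [LHS]addnC => /eqP.
by rewrite eqn_add2l => /eqP.
Qed.

Lemma dim_divfree m : \dim (divfree m) = 'C(m, 2).
Proof.
have := dimv_disjoint_sum (cocycles_cap_divfree m).
rewrite cocycles_add_divfree dim_pair_space dim_cocycles binS bin1 addnC.
by move/eqP; rewrite eqn_add2l => /eqP.
Qed.

(** Both kernels are the space of gradients, so [curl] can replace [pr_divfree] whenever
    dependencies are compared. *)
Lemma pr_divfree_eq0 m (x : pair_space R m.+1) :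
  pr_divfree m x = 0 <-> curl x = 0.
Proof.
rewrite pr_divfreeE lfunE /=; split=> [/subr0_eq ->|/curl_eq0 ->].
  exact: curl_grad.
by rewrite grad_part_grad subrr.
Qed.

End Decomposition.

(** * The group acting on permutations, and cutting a cyclic order *)

Lemma omega0K n : (omega0 n ^+ 2 = 1)%g.
Proof. by apply/permP => i; rewrite expgS expg1 permM !permE rev_ordK. Qed.

Lemma twist1 n (t : 'S_n) : twist 1%g t = t.
Proof. by rewrite /twist /= invg1 mul1g expg0 mulg1. Qed.

Lemma twistM n (g h : 'Z_2 * 'S_n) (t : 'S_n) :
  twist (g * h)%g t = twist h (twist g t).
Proof.
rewrite /twist /= invMg !mulgA -!mulgA -expgD; congr (_ * (_ * (_ * _)))%g.
(* Exponents add modulo 2, which is harmless since [omega0] is an involution. *)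
by rewrite expg_mod ?omega0K.
Qed.

Lemma twistE n (g : 'Z_2 * 'S_n) (t : 'S_n) (i : 'I_n) :
  twist g t i = (omega0 n ^+ g.1)%g (t (g.2^-1%g i)).
Proof. by rewrite /twist !permM. Qed.

(* u is the linear order obtained by cutting the cyclic order of t at ord_max. *)
Lemma cyclic_cut m (t : 'S_m.+1) : exists u : 'S_m, forall i j : 'I_m,
  i != j ->
  ((u j < u i)%N + 1 =
   (t (lift ord_max j) < t (lift ord_max i)) +
   (t ord_max < t (lift ord_max j)) + (t (lift ord_max i) < t ord_max))%N.
Proof.
pose l := t ord_max; pose r (i : 'I_m) := t (lift ord_max i).
have r_inj i j : r i = r j :> nat -> i = j.
  by move=> /val_inj/perm_inj/lift_inj.
have r_max i : r i != l :> nat.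
  by rewrite (inj_eq val_inj) (inj_eq perm_inj) eq_sym neq_lift.
(* This is r i - l - 1 modulo m + 1: values are counted cyclically from just after [l]. The residue
   m would force r i = l. *)
pose f i := if (r i < l)%N then (r i + (m - l))%N else (r i - l.+1)%N.
have lt_f i : (f i < m)%N.
  have := r_max i; have := ltn_ord (r i); have := ltn_ord l; rewrite /f.
  by case: (ltnP (r i) l); lia.
have f_inj : injective (fun i => Ordinal (lt_f i)).
  move=> i j [fij]; apply: r_inj; move: fij; rewrite /f.
  have := r_max i; have := ltn_ord (r i); have := r_max j.
  have := ltn_ord (r j); have := ltn_ord l.
  by case: (ltnP (r i) l); case: (ltnP (r j) l); lia.
(* Three distinct values arranged in a cycle have one or two descents; they have two exactly when
   [u] has a descent from [i] to [j]. *)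
exists (perm f_inj) => i j ne_ij; rewrite !permE /= -/l -/(r i) -/(r j) /f.
have ne_r : r i != r j :> nat by apply: contra_neq ne_ij; apply: r_inj.
have := r_max i; have := ltn_ord (r i); have := r_max j.
have := ltn_ord (r j); have := ltn_ord l.
by case: (ltnP (r i) l); case: (ltnP (r j) l); lia.
Qed.

(** * Row sums, circulations and symmetries of the vertices *)

Section Vertices.
Variable R : realType.

(** Below the diagonal, skew symmetry gives minus the opposite comparison, that is the comparison
    itself minus 1. The subtracted term does not depend on [t], so it drops out of combinations of
    weight 0. *)
Lemma entry_lo_vertex n (t : 'S_n) (i j : 'I_n) :
  entry i j (lo_vertex R n t) = (t j < t i)%N%:R - (j < i)%N%:R.
Proof.
case: (ltngtP i j) => [lt_ij|lt_ji|/val_inj ->].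
- by rewrite (entry_ffun (fun i j => (t j < t i)%N%:R)) // subr0.
- rewrite entryC (entry_ffun (fun i j => (t j < t i)%N%:R)) //.
  have : t i != t j :> nat.
    by apply: contraTneq lt_ji => /val_inj/perm_inj ->; rewrite ltnn.
  by case: ltngtP; rewrite ?oppr0 ?subrr ?sub0r.
- by rewrite entryxx ltnn subrr.
Qed.

Lemma entry_comb n (c : 'S_n -> R) (s : 'S_n -> 'S_n) (i j : 'I_n) :
  \sum_t c t = 0 ->
  entry i j (\sum_t c t *: lo_vertex R n (s t)) =
  \sum_t c t * (s t j < s t i)%N%:R.
Proof.
move=> c0; rewrite linear_sum /=.
under eq_bigr do rewrite linearZ /= entry_lo_vertex /GRing.scale /= mulrBr.
by rewrite sumrB -mulr_suml c0 mul0r subr0.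
Qed.

(** The permutation in [g] relabels rows and columns; [omega0] reverses every comparison, which by
    skew symmetry is a change of sign. *)
Lemma entry_twist n (c : 'S_n -> R) (g : 'Z_2 * 'S_n) (i j : 'I_n) :
  \sum_t c t = 0 ->
  entry i j (\sum_t c t *: lo_vertex R n (twist g t)) =
  (-1) ^+ g.1 * entry (g.2^-1%g i) (g.2^-1%g j)
                  (\sum_t c t *: lo_vertex R n t).
Proof.
move=> c0; rewrite entry_comb //; under eq_bigr do rewrite !twistE.
case: g => -[[|[|//]] lt_e] s /=.
  rewrite mul1r (entry_comb id) //.
  by apply: eq_bigr => t _; rewrite expg0 !perm1.
rewrite mulN1r -entryC (entry_comb id) //; apply: eq_bigr => t _.
rewrite expg1 ![omega0 n _]permE /=; congr (_ * _%:R).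
by have := ltn_ord (t (s^-1%g i)); have := ltn_ord (t (s^-1%g j)); lia.
Qed.

Lemma div_twist n (c : 'S_n -> R) (g : 'Z_2 * 'S_n) (i : 'I_n) :
  \sum_t c t = 0 ->
  div i (\sum_t c t *: lo_vertex R n (twist g t)) =
  (-1) ^+ g.1 * div (g.2^-1%g i) (\sum_t c t *: lo_vertex R n t).
Proof.
move=> c0; rewrite /div mulr_sumr [RHS](reindex_inj (@perm_inj _ g.2^-1%g)).
by apply: eq_bigr => j _; rewrite entry_twist.
Qed.

(** Since [curl] singles out the last index, its invariance under all permutations is seen through
    its kernel: a twisted gradient is the gradient of the relabelled, signed potential. *)
Lemma curl_twist m (c : 'S_m.+1 -> R) (g : 'Z_2 * 'S_m.+1) :
  \sum_t c t = 0 -> curl (\sum_t c t *: lo_vertex R m.+1 t) = 0 ->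
  curl (\sum_t c t *: lo_vertex R m.+1 (twist g t)) = 0.
Proof.
move=> c0 /curl_eq0 cE; set a := fun i => entry i ord_max _ in cE.
suff -> : \sum_t c t *: lo_vertex R m.+1 (twist g t) =
    grad (fun i => (-1) ^+ g.1 * a (g.2^-1%g i)) by apply: curl_grad.
by apply: eq_entry => i j; rewrite entry_twist // cE !entry_grad mulrBr.
Qed.

(** The number of j with t j < t i is the value t i counted from 0; the shift by one is killed by
    the weight 0. *)
Lemma sum_permutahedron_vertex n (c : 'S_n -> R) (s : 'S_n -> 'S_n) :
  \sum_t c t = 0 ->
  \sum_t c t *: permutahedron_vertex R n (s t) =
  \row_i div i (\sum_t c t *: lo_vertex R n (s t)).
Proof.
move=> c0; apply/rowP => i; rewrite summxE mxE /div.
under [RHS]eq_bigr do rewrite entry_comb //.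
rewrite exchange_big /= -[RHS]add0r -[X in _ = X + _]c0 -big_split /=.
apply: eq_bigr => t _.
rewrite !mxE -mulr_sumr -natr_sum -[in LHS](sum_ltn (s t i)).
by rewrite (reindex_inj (@perm_inj _ (s t))) /= mulrSr mulrDr mulr1 addrC.
Qed.

(** Of the three entries around i < j < n only the one at (n, i) lies below the diagonal; its offset
    -1 matches the [+ 1] of the hypothesis. *)
Lemma curl_lo_vertex m (t : 'S_m.+1) (u : 'S_m) :
  (forall i j : 'I_m, i != j ->
    ((u j < u i)%N + 1 =
     (t (lift ord_max j) < t (lift ord_max i)) +
     (t ord_max < t (lift ord_max j)) + (t (lift ord_max i) < t ord_max))%N) ->
  curl (lo_vertex R m.+1 t) = lo_vertex R m u.
Proof.
move=> uE; apply/ffunP => p; rewrite !ffunE /= !entry_lo_vertex !lift_max /=.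
have lt_p := valP p; have ne_p : (val p).1 != (val p).2.
  by rewrite -(inj_eq val_inj) neq_ltn lt_p.
have /(congr1 (fun k : nat => k%:R : R)) := uE _ _ ne_p; rewrite !natrD.
rewrite [((val p).2 < (val p).1)%N]ltnNge (ltnW lt_p) ltn_ord.
rewrite [(m < _)%N]ltnNge (ltnW (ltn_ord _)) /=; lra.
Qed.

End Vertices.

(** * The two projections, their isomorphisms and the actions *)

Theorem theorem1 (R : realType) (n : nat) (hn : (2 <= n)%N) :
  exists (aP : 'Z_2 * 'S_n -> pair_space R n -> pair_space R n)
         (aPi : 'Z_2 * 'S_n -> 'rV[R]_n -> 'rV[R]_n),
    natural_action (lo_vertex R n) aP /\
    natural_action (permutahedron_vertex R n) aPi /\
    exists (dot : {dot (pair_space R n) for idfun})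
           (V1 V2 : {vspace (pair_space R n)})
           (pr1 pr2 : 'End(pair_space R n)),
      [/\ (V1 + V2)%VS = fullv,
          (V1 :&: V2)%VS = 0%VS,
          forall u v, u \in V1 -> v \in V2 -> dot u v = 0,
          \dim V1 = n.-1
        & \dim V2 = 'C(n.-1, 2)] /\
      orth_proj dot V1 pr1 /\
      orth_proj dot V2 pr2 /\
      [/\ affinely_isomorphic (pr1 @` lo_polytope R n) (permutahedron R n),
          affinely_isomorphic (pr2 @` lo_polytope R n) (lo_polytope R n.-1),
          exists phi1 : pair_space R n -> 'rV[R]_n,
            affine_iso (pr1 @` lo_polytope R n) (permutahedron R n) phi1 /\
            equivariant (lo_polytope R n) aP aPi (phi1 \o pr1)
        & forall phi2 : pair_space R n -> pair_space R n.-1,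
            affine_iso (pr2 @` lo_polytope R n) (lo_polytope R n.-1) phi2 ->
            exists b : 'Z_2 * 'S_n -> pair_space R n.-1 -> pair_space R n.-1,
              affine_action (lo_polytope R n.-1) b /\
              equivariant (lo_polytope R n) aP b (phi2 \o pr2)].
Proof.
case: n hn => [//|m] _ /=; set v := lo_vertex R m.+1.
set q := permutahedron_vertex R m.+1.
have q_comb := @sum_permutahedron_vertex R m.+1.
(* Weight-zero combinations of the [q t] are row sums, which a twist permutes up to a common
   sign. *)
have q_twist g c : affine_dep q c -> affine_dep (q \o twist g) c.
  move=> [c0]; rewrite (q_comb _ id) // => /rowP cq; split=> //=.
  rewrite (q_comb _ (twist g)) //; apply/rowP => i; rewrite !mxE div_twist //.
  by have := cq (g.2^-1%g i); rewrite !mxE => ->; rewrite mulr0.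
have [aP [aP_act aPv]] : exists a : 'Z_2 * 'S_m.+1 -> _,
    affine_action (conv_hull (range v)) a /\
    forall g t, a g (v t) = v (twist g t).
  apply: affine_action_exists => [||g c [c0 cv]];
    [exact: twist1|exact: twistM|].
  split=> //; apply: eq_entry => i j.
  by rewrite entry_twist // cv !linear0 mulr0.
have [aPi [aPi_act aPiq]] := affine_action_exists (@twist1 m.+1)
  (@twistM m.+1) q_twist.
exists aP, aPi; do 2![split; first by split].
exists (@pair_dot R m.+1), (cocycles R m), (divfree R m), (pr_grad R m),
  (pr_divfree R m).
split.
  split; [exact: cocycles_add_divfree|exact: cocycles_cap_divfree|
    exact: cocycles_orthogonal|exact: dim_cocycles|exact: dim_divfree].
split; first exact: pr_grad_orth_proj.
split; first exact: pr_divfree_orth_proj.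
have pr_comb (f : 'End(pair_space R m.+1)) c (s : 'S_m.+1 -> 'S_m.+1) :
    \sum_t c t *: f (v (s t)) = f (\sum_t c t *: v (s t)).
  by rewrite linear_sum; apply: eq_bigr => t _; rewrite linearZ.
have imE (f : 'End(pair_space R m.+1)) :
    f @` lo_polytope R m.+1 = conv_hull (range (f \o v)).
  by apply: image_conv_hull; apply: linear_affine_on.
(* [pr_grad] kills exactly the matrices with zero row sums, and these row sums are the combinations
   of the [q t]. *)
have dep1 c : affine_dep (pr_grad R m \o v) c <-> affine_dep q c.
  split=> -[c0].
    rewrite (pr_comb _ _ id) lfunE => /grad_part_eq0 x0.
    by split; rewrite // (q_comb _ id) //; apply/rowP => i; rewrite !mxE x0.
  rewrite (q_comb _ id) // => /rowP x0; split; rewrite // (pr_comb _ _ id) lfunE.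
  by apply/grad_part_eq0 => i; have := x0 i; rewrite !mxE.
have [cut cutE] := choice (@cyclic_cut m).
have curl_v t := curl_lo_vertex R (cutE t).
have curl_comb c : curl (\sum_t c t *: v t) =
    \sum_t c t *: (lo_vertex R m \o cut) t.
  by rewrite linear_sum; apply: eq_bigr => t _; rewrite linearZ /= curl_v.
(* [curl] has the kernel of [pr_divfree] and sends the vertex of [t] to the vertex of [cut t]. *)
have dep2 c : affine_dep (pr_divfree R m \o v) c <->
    affine_dep (lo_vertex R m \o cut) c.
  split=> -[c0]; rewrite ?(pr_comb _ _ id) -?curl_comb => /pr_divfree_eq0 x0.
    by split; rewrite // -curl_comb.
  by split; rewrite // (pr_comb _ _ id).
have cut_surj : range (lo_vertex R m \o cut) = range (lo_vertex R m).
  apply/seteqP; split=> y [u _ <-]; first by exists (cut u).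
  (* Giving [ord_max] the largest value and then cutting there returns [u]. *)
  exists (lift_perm ord_max ord_max u) => //=; apply/ffunP => p; rewrite !ffunE.
  have ne_p : (val p).1 != (val p).2.
    by rewrite -(inj_eq val_inj) neq_ltn (valP p).
  have := cutE (lift_perm ord_max ord_max u) _ _ ne_p.
  rewrite lift_perm_id !lift_perm_lift !lift_max.
  have := ltn_ord (u (val p).1); have := ltn_ord (u (val p).2).
  by move=> /= lt2 lt1; rewrite lt1 [(m < _)%N]ltnNge (ltnW lt2) addn0;
    move=> /addIn ->.
(* The smaller polytope is now the hull of a family with repetitions, indexed like the projected
   vertices. *)
rewrite !imE /lo_polytope /permutahedron -/v -/q -cut_surj.
(* One inclusion of dependencies yields the affine map [phi], the other its injectivity. *)
have iso (F : lmodType R) (f : 'End(pair_space R m.+1)) (u : 'S_m.+1 -> F) :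
    (forall c, affine_dep (f \o v) c <-> affine_dep u c) ->
    exists phi,
      affine_iso (conv_hull (range (f \o v))) (conv_hull (range u)) phi /\
      forall t, phi (f (v t)) = u t.
  move=> fu; have [|phi [phiA phiE]] := @affine_extension R _ _ _ (f \o v) u.
    by move=> c /fu.
  have uE : u = phi \o (f \o v) by apply/funext => t /=; rewrite -phiE.
  by exists phi; split=> //; rewrite uE; apply: affine_isoP => // c;
    rewrite -uE => /fu.
have aff_comp (F : lmodType R) (f : 'End(pair_space R m.+1)) B
    (phi : pair_space R m.+1 -> F) :
    affine_iso (conv_hull (range (f \o v))) B phi ->
    affine_on (affine_hull (range v)) (phi \o f).
  rewrite /affine_iso affine_hull_conv_hull => -[phiA _ _] k x w xv w1 /=.
  have -> : f (\sum_i w i *: x i) = \sum_i w i *: f (x i).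
    by rewrite linear_sum; apply: eq_bigr => i _; rewrite linearZ.
  rewrite phiA // => i; have /affine_hull_rangeP[c c1 ->] := xv i.
  by apply/affine_hull_rangeP; exists c; rewrite // (pr_comb _ _ id).
have [phi1 [phi1_iso phi1E]] := iso _ _ _ dep1.
split.
- by exists phi1.
- by have [phi2 [? _]] := iso _ _ _ dep2; exists phi2.
- exists phi1; split=> //; have phi1q : (phi1 \o pr_grad R m) \o v = q.
    by apply/funext => t /=; rewrite phi1E.
  apply: equivariant_of_vertices aPv _ => //; first exact: aff_comp phi1_iso.
    by rewrite phi1q.
  by move=> g t /=; rewrite !phi1E.
- move=> phi2 phi2_iso; pose w := phi2 \o (pr_divfree R m \o v).
  have phi2A : affine_on (affine_hull (range (pr_divfree R m \o v))) phi2.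
    by case: phi2_iso; rewrite affine_hull_conv_hull.
  (* Injectivity of [phi2] pulls a dependency of [w] back to the projected vertices. There it means
     zero curl, which twisting preserves, and [phi2] carries the result forward. *)
  have w_twist g c : affine_dep w c -> affine_dep (w \o twist g) c.
    move=> /(affine_iso_dep phi2_iso)[c0].
    rewrite (pr_comb _ _ id) => /pr_divfree_eq0 cv.
    apply: (affine_on_dep (v := (pr_divfree R m \o v) \o twist g) phi2A) => [t|].
      exact: (mem_affine_hull_range (pr_divfree R m \o v)).
    split=> //=.
    rewrite (pr_comb _ _ (twist g)); apply/pr_divfree_eq0; exact: curl_twist.
  have [b [b_act bw]] := affine_action_exists (@twist1 m.+1)
    (@twistM m.+1) w_twist.
  (* As [phi2] is onto, the action built on the points [w t] lives on the whole smaller polytope. *)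
  have wE : conv_hull (range w) = conv_hull (range (lo_vertex R m \o cut)).
    rewrite /w -image_conv_hull //.
    have [_ _ [phi2_fun _ phi2_surj]] := phi2_iso.
    by apply/seteqP; split=> // y [x xP <-]; apply: phi2_fun.
  exists b; rewrite -wE; split=> //.
  by apply: equivariant_of_vertices aPv bw => //; exact: aff_comp phi2_iso.
Qed.
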